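(* Let $d\geq1$ and let $x,y\in\{0,1,\dots,d\}^{\mathbb{Z}^d}$ be such that $x$ is uniformly recurrent. The pair $(x,y)$ is an indistinguishable asymptotic pair satisfying the flip condition if and only if there exists a totally irrational vector $\alpha\in[0,1)^d$ such that $x=c_\alpha$ and $y=c'_\alpha$ are the lower and upper characteristic $d$-dimensional Sturmian configurations with slope $\alpha$.
   Context: Let $e_1,\dots,e_d$ be the canonical basis of $\mathbb{Z}^d$. For a finite alphabet $\Sigma$, elements of $\Sigma^{\mathbb{Z}^d}$ are configurations; the shift is $\sigma^u(x)_v=x_{u+v}$. A pattern is a map $p\colon S\to\Sigma$ with $S\subset\mathbb{Z}^d$ finite. $\mathrm{occ}_p(x)=\{n\in\mathbb{Z}^d:\sigma^n(x)|_S=p\}$. A configuration $x$ is uniformly recurrent if for every pattern $p$ with $\mathrm{occ}_p(x)\ne\varnothing$ there is a finite $K\subset\mathbb{Z}^d$ such that for every $u\in\mathbb{Z}^d$ there is $k\in K$ with $u+k\in\mathrm{occ}_p(x)$. Configurations $x,y$ are asymptotic if the difference set $\{u: x_u\neq y_u\}$ is finite. An asymptotic pair $(x,y)$ is indistinguishable if $\#(\mathrm{occ}_p(x)\setminus\mathrm{occ}_p(y))=\#(\mathrm{occ}_p(y)\setminus\mathrm{occ}_p(x))$ for every pattern $p$ of finite support. Flip condition for an asymptotic pair $x,y\in\{0,\dots,d\}^{\mathbb{Z}^d}$: (1) the difference set is $F=\{0,-e_1,\dots,-e_d\}$; (2) $x|_F$ is a bijection $F\to\{0,\dots,d\}$;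 (3) the map $x_n\mapsto y_n$ ($n\in F$) is a cyclic permutation (a single cycle of length $d+1$) of $\{0,\dots,d\}$; with the standing normalization that $x_0=0$ and $y_n=x_n-1 \bmod (d+1)$ for every $n\in F$. A vector $\alpha=(\alpha_1,\dots,\alpha_d)$ is totally irrational if $1,\alpha_1,\dots,\alpha_d$ are linearly independent over $\mathbb{Q}$. For totally irrational $\alpha\in[0,1)^d$, the lower and upper characteristic $d$-dimensional Sturmian configurations with slope $\alpha$ are $c_\alpha,c'_\alpha\colon\mathbb{Z}^d\to\{0,\dots,d\}$, $$c_\alpha(n)=\sum_{i=1}^d\left(\lfloor\alpha_i+n\cdot\alpha\rfloor-\lfloor n\cdot\alpha\rfloor\right),\qquad c'_\alpha(n)=\sum_{i=1}^d\left(\lceil\alpha_i+n\cdot\alpha\rceil-\lceil n\cdot\alpha\rceil\right).$$ *)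

(* Defs.v *)
From HB Require Import structures.
From mathcomp Require Import all_boot all_order all_algebra all_fingroup.
From mathcomp Require Import finmap.
From mathcomp Require Import all_classical all_reals.

Set Implicit Arguments.
Unset Strict Implicit.
Unset Printing Implicit Defensive.

Import Order.TTheory GRing.Theory Num.Theory.

Local Open Scope classical_set_scope.
Local Open Scope ring_scope.

(* Z^d is 'rV[int]_d; its canonical basis vectors are the delta_mx 0 i. *)
Definition configuration (d : nat) (Sigma : finType) : Type :=
  'rV[int]_d -> Sigma.

Section Configurations.
Variables (d : nat) (Sigma : finType).
Implicit Types (x y : configuration d Sigma) (S : {fset 'rV[int]_d}).

Definition shift (u : 'rV[int]_d) x : configuration d Sigma :=
  fun v => x (u + v).

Definition restriction S x : S -> Sigma := fun s => x (val s).

Definition occ S (p : S -> Sigma) x : set 'rV[int]_d :=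
  [set n | @restriction S (shift n x) = p].

Definition uniformly_recurrent x : Prop :=
  forall S (p : S -> Sigma), occ p x !=set0 ->
    exists K : {fset 'rV[int]_d},
      forall u, exists2 k, k \in K & occ p x (u + k).

Definition difference_set x y : set 'rV[int]_d := [set u | x u <> y u].

Definition asymptotic x y : Prop := finite_set (difference_set x y).

(* #= is equipotence; for an asymptotic pair both sets are finite. *)
Definition indistinguishable x y : Prop :=
  forall S (p : S -> Sigma),
    (occ p x `\` occ p y #= occ p y `\` occ p x)%card.

Definition indistinguishable_asymptotic_pair x y : Prop :=
  asymptotic x y /\ indistinguishable x y.

End Configurations.

Definition flip_set (d : nat) : set 'rV[int]_d :=
  [set u | u = 0 \/ exists i : 'I_d, u = - delta_mx 0 i].
Arguments flip_set d : clear implicits.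

(* The last two fields are the usual normalization of the letters; given the
   other fields, flip_pred already implies flip_cycle, which is kept because it
   is part of the definition. *)
Record flip_condition (d : nat) (x y : configuration d 'I_d.+1) : Prop := {
  flip_diff : difference_set x y = flip_set d;
  flip_bij : set_bij (flip_set d) [set: 'I_d.+1] x;
  flip_cycle : exists s : {perm 'I_d.+1},
    (forall n, flip_set d n -> y n = s (x n)) /\ #|porbit s ord0| = d.+1;
  flip_zero : x 0 = ord0;
  flip_pred : forall n, flip_set d n ->
    (y n)%:Z = (((x n)%:Z - 1) %% d.+1)%Z
}.

Section Sturmian.
Variables (R : realType) (d : nat).
Implicit Types (alpha : 'rV[R]_d) (n : 'rV[int]_d).

Definition totally_irrational alpha : Prop :=
  forall (q0 : rat) (q : 'I_d -> rat),
    ratr q0 + \sum_(i < d) ratr (q i) * alpha 0 i = 0 :> R ->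
    q0 = 0 /\ forall i, q i = 0.

Definition dot n alpha : R := \sum_(i < d) (n 0 i)%:~R * alpha 0 i.

(* When alpha has entries in [0, 1[ each summand is 0 or 1, so the values of
   the two functions below lie in {0, .., d}. *)
Definition lower_sturmian alpha n : int :=
  \sum_(i < d)
    (Num.floor (alpha 0 i + dot n alpha) - Num.floor (dot n alpha)).

Definition upper_sturmian alpha n : int :=
  \sum_(i < d)
    (Num.ceil (alpha 0 i + dot n alpha) - Num.ceil (dot n alpha)).

End Sturmian.

(* Main.v *)
Require Import Defs.
From mathcomp Require Import all_boot all_order all_algebra all_fingroup.
From mathcomp Require Import finmap.
From mathcomp Require Import all_classical all_reals.
From mathcomp Require Import zify ring lra.

Set Implicit Arguments.
Unset Strict Implicit.
Unset Printing Implicit Defensive.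

Import Order.TTheory GRing.Theory Num.Theory.

Local Open Scope classical_set_scope.
Local Open Scope ring_scope.

(** Both directions rest on a height function. For a Sturmian configuration it
is [f n = floor (dot n alpha)]: the letter at [n] is the number of directions in
which [f] goes up by one, and the upper configuration is obtained by lowering
the height by one at the origin only.

From indistinguishable pairs to Sturmian ones, the engine is a rigidity
principle ([local_rigid]): a predicate that depends on a finite window and takes
the same value on [x] and [y] at each place is constant on the lattice. It comes
from indistinguishability by counting ([local_sum]) together with the fact that
the flip permutes the letters of the flip set in one cycle. It is used twice.
First, the letter at [n] determines in which directions the height should go up
at [n]. The obstruction to integrate these rises is a local function that is
common to [x] and [y], so it is constant, and it vanishes because the rises are
bounded ([rise_cocycle]); this gives the height [f]. Second, the increment of
the height over a vector [v] changes under the flip at two places only, and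
counting shows that it changes from [f v] to [f v + 1] at one of them and back
at the other. By rigidity the increment over [v] takes no other value
([height_balanced]). So [f] is a quasi-morphism with defect in 0, 1, and lies
within 1 below a linear form [dot v alpha]. Uniform recurrence excludes that
[dot v alpha] is an integer for a nonzero [v] ([slope_irrational]): otherwise,
up to the sign of [v], a line directed by [v] would contain at most one
increment over [v] larger than the minimal one, whereas recurrence yields two.
Therefore [alpha] is totally irrational and [f] is the floor of [dot v alpha].

Conversely, for a Sturmian pair and a finite window, order the finitely many
places whose window meets the flip set by the position of [dot n alpha] on the
circle. Between two cyclically consecutive points no coding interval begins, so
that the pattern of [x] at a place is the pattern of [y] at its successor
([successor_agree]). The successor is a permutation of these places, which gives
indistinguishability. *)

(** * Patterns and indistinguishability *)

Definition pattern_at (d : nat) (Sigma : finType) (S : {fset 'rV[int]_d})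
    (x : configuration d Sigma) (n : 'rV[int]_d) : {ffun S -> Sigma} :=
  [ffun s => x (n + val s)].

Definition agree (d : nat) (Sigma : finType) (S : {fset 'rV[int]_d})
    (x : configuration d Sigma) n (y : configuration d Sigma) m : Prop :=
  forall s, s \in S -> x (n + s) = y (m + s).

Section Patterns.
Variables (d : nat) (Sigma : finType).
Implicit Types (x y : configuration d Sigma) (S : {fset 'rV[int]_d}).
Implicit Types (n m : 'rV[int]_d) (A : seq 'rV[int]_d).

Lemma pattern_atP S x n y m :
  pattern_at S x n = pattern_at S y m <-> agree S x n y m.
Proof.
split=> [/ffunP e s sS|e]; first by have := e [` sS]%fset; rewrite !ffunE.
by apply/ffunP=> s; rewrite !ffunE; apply: e; apply: valP.
Qed.

Lemma occE S (p : S -> Sigma) x n :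
  occ p x n <-> pattern_at S x n = finfun p.
Proof.
rewrite /occ /= /restriction /shift; split=> [<-|/ffunP e].
  by apply/ffunP=> s; rewrite !ffunE.
by apply: funext => s; have := e s; rewrite !ffunE.
Qed.

Lemma card_eq_seq (T : choiceType) (s t : seq T) : uniq s -> uniq t ->
  ([set` s] #= [set` t])%card <-> size s = size t.
Proof.
have setE (r : seq T) : [set` r] = [set` [fset z in r]%fset].
  by apply/seteqP; split=> z /=; rewrite inE.
have sizeE (r : seq T) : uniq r -> #|` [fset z in r]%fset| = size r.
  by move=> ur; rewrite card_fseq undup_id.
move=> us ut; rewrite (setE s) (setE t) -(sizeE s us) -(sizeE t ut); split=> [|e].
  move=> /fcard_eq; rewrite !set_fsetK; apply; exact: finite_fset.
by apply/fcard_eq; [exact: finite_fset|exact: finite_fset|rewrite !set_fsetK].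
Qed.

(** The occurrences outside the finite list [A] are common to [x] and [y], and
those inside can be counted. Adding the common occurrences in [A] to both
difference sets turns the comparison of cardinals into an equality of multisets of patterns
read along [A], a form that can be summed over. *)
Lemma indistinguishable_permP x y S A : uniq A ->
    (forall n, n \notin A -> agree S x n y n) ->
  (forall p : S -> Sigma, (occ p x `\` occ p y #= occ p y `\` occ p x)%card) <->
  perm_eq [seq pattern_at S x n | n <- A] [seq pattern_at S y n | n <- A].
Proof.
move=> uA xyA.
have occDE (z t : configuration d Sigma) (p : S -> Sigma) :
    (forall n, n \notin A -> agree S z n t n) ->
    occ p z `\` occ p t = [set` [seq n <- A |
      (pattern_at S z n == finfun p) && (pattern_at S t n != finfun p)]].
  move=> ztA; apply/seteqP; split=> n /=; rewrite mem_filter.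
    move=> [/occE zp tp]; rewrite zp eqxx /=; apply/andP; split.
      by apply/eqP=> /occE.
    apply: contra_notT tp => /ztA/pattern_atP ztn.
    by apply/occE; rewrite -ztn.
  by move=> /andP[/andP[/eqP zp /eqP tp] nA]; split; [exact/occE|move=> /occE].
pose P q n := pattern_at S x n == q; pose Q q n := pattern_at S y n == q.
have -> : perm_eq [seq pattern_at S x n | n <- A]
                  [seq pattern_at S y n | n <- A] <->
  forall q, size [seq n <- A | P q n && ~~ Q q n] =
            size [seq n <- A | Q q n && ~~ P q n].
  have countE (a b : pred 'rV[int]_d) :
      count a A = (size [seq n <- A | a n && b n] +
                   size [seq n <- A | a n && ~~ b n])%N.
    by elim: A {uA xyA occDE} => //= n A ->; case: (a n); case: (b n) => /=; lia.
  have PQE q : count (pred1 q) [seq pattern_at S x n | n <- A] =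
               count (pred1 q) [seq pattern_at S y n | n <- A] <->
      size [seq n <- A | P q n && ~~ Q q n] =
      size [seq n <- A | Q q n && ~~ P q n].
    rewrite !count_map (countE (preim _ _) (Q q)) (countE (preim _ (pred1 q)) (P q)).
    rewrite (eq_filter (a1 := fun n => _ && P q n) (a2 := fun n => P q n && Q q n)).
      by split=> [/addnI|->].
    by move=> n; rewrite andbC.
  split=> [/seq.permP e q|e]; first exact/PQE/e.
  by apply/allP=> q _ /=; apply/eqP/PQE.
split=> [e q|e p]; have yxA n : n \notin A -> agree S y n x n.
- by move=> /xyA nA s /nA.
- have := e (fun s => q s); rewrite (occDE _ _ _ xyA) (occDE _ _ _ yxA).
  have -> : [ffun s => q s] = q by apply/ffunP=> s; rewrite ffunE.
  by move/card_eq_seq; apply; apply: filter_uniq.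
- by move=> /xyA nA s /nA.
- rewrite (occDE _ _ _ xyA) (occDE _ _ _ yxA).
  by apply/card_eq_seq; rewrite ?filter_uniq ?e.
Qed.

End Patterns.

(** * Local functions of a pair of configurations *)

Section Lattice.
Variable d : nat.

Lemma lattice_ind (P : 'rV[int]_d -> Prop) : P 0 ->
    (forall (v : 'rV[int]_d) i, P v -> P (v + delta_mx 0 i)) ->
    (forall (v : 'rV[int]_d) i, P v -> P (v - delta_mx 0 i)) ->
  forall v, P v.
Proof.
move=> P0 PD PB v; rewrite [v]row_sum_delta.
elim: (index_enum _) => [|i r IH]; first by rewrite big_nil.
rewrite big_cons addrC; elim: (v 0 i) => [|k IHk|k IHk].
- by rewrite scale0r addr0.
- by rewrite [k.+1%:Z]intS scalerDl scale1r addrCA addrC; apply: PD.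
- by rewrite [k.+1%:Z]intS opprD scalerDl scaleN1r addrCA addrC; apply: PB.
Qed.

End Lattice.

Section Local.
Variables (d : nat) (Sigma : finType) (z : bool -> configuration d Sigma).
Implicit Types (n m k : 'rV[int]_d).

(** The value at [n] is determined by the letters in a finite window around [n],
by the same rule for both configurations [z false] and [z true]. *)
Definition local (T : Type) (phi : bool -> 'rV[int]_d -> T) : Prop :=
  exists S, forall b c n m, agree S (z b) n (z c) m -> phi b n = phi c m.

Lemma local_ext T (phi psi : bool -> 'rV[int]_d -> T) :
  (forall b n, phi b n = psi b n) -> local phi -> local psi.
Proof.
by move=> e [S Sphi]; exists S => b c n m a; rewrite -!e; apply: Sphi.
Qed.

Lemma local_map2 T U V (F : T -> U -> V) phi psi : local phi -> local psi ->
  local (fun b n => F (phi b n) (psi b n)).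
Proof.
move=> [S Sphi] [S' Spsi]; exists (S `|` S')%fset => b c n m e; congr F.
  by apply: Sphi => s sS; apply: e; rewrite inE sS.
by apply: Spsi => s sS; apply: e; rewrite inE sS orbT.
Qed.

Lemma local_map T U (F : T -> U) phi : local phi ->
  local (fun b n => F (phi b n)).
Proof. by move=> [S Sphi]; exists S => b c n m e; congr F; apply: Sphi. Qed.

Lemma local_shift T (phi : bool -> 'rV[int]_d -> T) k : local phi ->
  local (fun b n => phi b (n + k)).
Proof.
move=> [S Sphi]; exists [fset (k + s)%R | s in S]%fset => b c n m e.
apply: Sphi => s sS; rewrite -!addrA; apply: e.
by apply/imfsetP; exists s.
Qed.

Lemma local_letter : local z.
Proof.
exists [fset 0%R]%fset => b c n m /(_ 0); rewrite !addr0; apply.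
by rewrite inE.
Qed.

Lemma local_cst T (t : T) : local (fun _ _ => t).
Proof. by exists fset0. Qed.

Hypothesis z_ind : indistinguishable (z false) (z true).
Variable F : seq 'rV[int]_d.
Hypothesis zF : forall n, n \notin F -> z false n = z true n.

(** The summable form of indistinguishability. A value read off a finite window
is a function of the pattern in that window, hence both sums run over the same
multiset of patterns. The list [A] may be smaller than the set of windows that
meet the difference set, since the terms outside [A] cancel. *)
Lemma local_sum T (phi : bool -> 'rV[int]_d -> T) (w : T -> int) A :
    local phi -> uniq A ->
    (forall n, n \notin A -> phi false n = phi true n) ->
  \sum_(n <- A) w (phi false n) = \sum_(n <- A) w (phi true n).
Proof.
move=> [S Sphi] uA phiA.
pose B := undup (A ++ [seq f - s | f <- F, s <- enum_fset S]).
have uB : uniq B by exact: undup_uniq.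
have zB n : n \notin B -> agree S (z false) n (z true) n.
  rewrite mem_undup mem_cat negb_or => /andP[_ nB] s sS; apply: zF.
  apply: contra nB => nsF; rewrite -[n](addrK s).
  exact: (allpairs_f (fun f s => f - s)).
have /(indistinguishable_permP uB zB) BP := @z_ind S.
(* The rule that computes the value from the pattern; patterns that occur in
   neither configuration get a dummy value. *)
pose Phi (q : {ffun S -> Sigma}) : T :=
  if pselect (exists p, pattern_at S (z p.1) p.2 = q) is left h
  then phi (projT1 (cid h)).1 (projT1 (cid h)).2 else phi false 0.
have PhiE b n : Phi (pattern_at S (z b) n) = phi b n.
  rewrite /Phi; case: pselect => [h|[]]; last by exists (b, n).
  by case: (cid h) => -[c m] /= /pattern_atP; apply: Sphi.
have sumB : \sum_(n <- B) w (phi false n) = \sum_(n <- B) w (phi true n).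
  under eq_bigr do rewrite -PhiE; under [RHS]eq_bigr do rewrite -PhiE.
  rewrite -(big_map (pattern_at S (z false)) xpredT (fun q => w (Phi q))).
  rewrite -(big_map (pattern_at S (z true)) xpredT (fun q => w (Phi q))).
  exact: perm_big.
have AB b : \sum_(n <- B) w (phi b n) =
    \sum_(n <- A) w (phi b n) + \sum_(n <- B | n \notin A) w (phi b n).
  rewrite (bigID (mem A)) /=; congr (_ + _).
  rewrite -big_filter; apply: perm_big; apply: uniq_perm; rewrite ?filter_uniq //.
  by move=> n; rewrite mem_filter mem_undup mem_cat; case: (n \in A).
have eB : \sum_(n <- B | n \notin A) w (phi false n) =
    \sum_(n <- B | n \notin A) w (phi true n).
  by apply: eq_bigr => n /phiA ->.
by move: sumB; rewrite !AB eB; move/addIr.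
Qed.

End Local.

(** * Letters on the flip set and rigidity of local functions *)

Definition flip_seq (d : nat) : seq 'rV[int]_d :=
  0 :: [seq - 'e_i | i <- enum 'I_d].

Lemma mem_flip_seq d (n : 'rV[int]_d) : (n \in flip_seq d) <-> flip_set d n.
Proof.
rewrite inE; split=> [/orP[/eqP->|/mapP[i _ ->]]|[->|[i ->]]].
- by left.
- by right; exists i.
- by rewrite eqxx.
- by apply/orP; right; apply: map_f; rewrite mem_enum.
Qed.

Lemma delta_neq0 d (i : 'I_d) : 'e_i != 0 :> 'rV[int]_d.
Proof. by apply/eqP=> /matrixP/(_ 0 i); rewrite !mxE !eqxx. Qed.

Lemma delta_inj d : injective (fun i : 'I_d => 'e_i : 'rV[int]_d).
Proof.
move=> i j /matrixP/(_ 0 i); rewrite !mxE !eqxx /=.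
by case: eqVneq.
Qed.

Lemma uniq_flip_seq d : uniq (flip_seq d).
Proof.
rewrite /= map_inj_uniq ?enum_uniq ?andbT; last by move=> i j /oppr_inj/delta_inj.
by apply/mapP=> -[i _ /eqP]; rewrite eq_sym oppr_eq0 (negPf (delta_neq0 i)).
Qed.

Section Rigidity.
Variables (d : nat) (x y : configuration d 'I_d.+1).
Implicit Types (n m k v : 'rV[int]_d) (i j : 'I_d).
Hypothesis xy_ind : indistinguishable x y.
Hypothesis xy_flip : flip_condition x y.

Definition side (b : bool) := if b then y else x.

Lemma flip_eq n : n \notin flip_seq d -> x n = y n.
Proof.
move=> /negP nF; apply: contrapT => xyn; apply: nF; apply/mem_flip_seq.
by rewrite -(flip_diff xy_flip).
Qed.

Lemma flip_x0 : x 0 = 0 :> nat. Proof. by rewrite (flip_zero xy_flip). Qed.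

Lemma flip_y0 : y 0 = d :> nat.
Proof.
have := flip_pred xy_flip (n := 0); rewrite flip_x0 => /(_ (or_introl erefl)).
by rewrite (_ : 0%:Z - 1 = Negz 0) // modNz_nat // mod0n; lia.
Qed.

Lemma flip_x_inj n m : n \in flip_seq d -> m \in flip_seq d -> x n = x m -> n = m.
Proof.
move=> /mem_flip_seq nF /mem_flip_seq mF.
by have [_ + _] := flip_bij xy_flip; apply; apply/mem_set.
Qed.

Lemma flip_x_surj (a : 'I_d.+1) : exists2 n, n \in flip_seq d & x n = a.
Proof.
have [_ _ /(_ a I)[n nF <-]] := flip_bij xy_flip.
by exists n => //; apply/mem_flip_seq.
Qed.

Lemma flip_yS n : n \in flip_seq d -> (0 < x n)%N -> (y n).+1 = x n :> nat.
Proof.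
move=> /mem_flip_seq nF x_gt0; have := flip_pred xy_flip nF.
by rewrite modz_small; have := ltn_ord (x n); lia.
Qed.

Lemma flip_xN i : (0 < x (- 'e_i)%R)%N.
Proof.
rewrite lt0n; apply/eqP=> xi0; have /eqP := delta_neq0 i; apply.
apply: oppr_inj; rewrite oppr0; apply: flip_x_inj.
- by apply/mem_flip_seq; right; exists i.
- by apply/mem_flip_seq; left.
- by apply: val_inj; rewrite /= xi0 flip_x0.
Qed.

Lemma flip_yN i : (y (- 'e_i)).+1 = x (- 'e_i) :> nat.
Proof.
by apply: flip_yS; [apply/mem_flip_seq; right; exists i|exact: flip_xN].
Qed.

(** Going from [x] to [y] lowers each nonzero letter by one and sends the letter
zero, found at the origin, to [d]. *)
Lemma flip_y_inj n m : n \in flip_seq d -> m \in flip_seq d -> y n = y m -> n = m.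
Proof.
have x_gt0 f : f \in flip_seq d -> f != 0 -> (0 < x f)%N.
  by case/mem_flip_seq=> [->|[i ->]] //; [rewrite eqxx|rewrite flip_xN].
move=> nF mF e; have [n0|n0] := eqVneq n 0; have [m0|m0] := eqVneq m 0.
- by rewrite n0 m0.
- have := flip_yS mF (x_gt0 _ mF m0); have := ltn_ord (x m).
  by rewrite -e n0 flip_y0; lia.
- have := flip_yS nF (x_gt0 _ nF n0); have := ltn_ord (x n).
  by rewrite e m0 flip_y0; lia.
- apply: flip_x_inj => //; apply: val_inj; rewrite /=.
  by rewrite -(flip_yS nF (x_gt0 _ nF n0)) e (flip_yS mF (x_gt0 _ mF m0)).
Qed.

(** A local predicate that cannot tell [x] from [y] is constant. Refine it by
recording in addition that the letter at a fixed offset equals [a], and sum the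
refined predicate over both configurations. Only the places that see the flip
set at this offset contribute, and the sums compare the value of the predicate
seen from the place where [x] has the letter [a] with its value seen from the
place where [y] has the letter [a], which is where [x] has the next letter.
As the letters on the flip set form a single cycle, the predicate takes one
value on every translate of the flip set, and these translates connect the
lattice. *)
Lemma local_rigid (phi : bool -> 'rV[int]_d -> bool) : local side phi ->
    (forall n, phi false n = phi true n) ->
  forall n m, phi false n = phi false m.
Proof.
move=> loc_phi phiE.
have step f f' k : f \in flip_seq d -> f' \in flip_seq d -> y f = x f' ->
    phi false (f + k) = phi false (f' + k).
  move=> fF f'F yfx.
  pose psi b n := phi b n && (side b (n + - k) == x f').
  have loc_psi : local side psi.
    apply: (local_map2 (fun p a => p && (a == x f')) loc_phi).
    exact: local_shift (local_letter _).
  have := @local_sum d _ side xy_ind (flip_seq d) flip_eq _ psi (fun b => (b : nat)%:Z)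
    [seq f + k | f <- flip_seq d] loc_psi.
  rewrite map_inj_uniq ?uniq_flip_seq; last exact: addIr.
  have uniq_term b g : g \in flip_seq d -> side b g = x f' ->
      (forall h, h \in flip_seq d -> side b h = x f' -> h = g) ->
      \sum_(n <- [seq f + k | f <- flip_seq d]) (psi b n : nat)%:Z = phi b (g + k).
    move=> gF gE gU; rewrite big_map (bigD1_seq g) ?uniq_flip_seq //=.
    rewrite big_seq_cond big1 ?addr0.
      by rewrite /psi addrK gE eqxx andbT.
    move=> h /andP[hF /eqP hg]; rewrite /psi addrK.
    by case: eqP => [/(gU _ hF)//|]; rewrite andbF.
  rewrite (uniq_term false f') ?(uniq_term true f) //.
  - move=> e; apply/esym; move: e; rewrite -phiE => e.
    have /e : forall n, n \notin [seq f + k | f <- flip_seq d] ->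
        psi false n = psi true n.
      move=> n nF; rewrite /psi phiE /= (@flip_eq (n - k)) //.
      by apply: contra nF => nF; rewrite -[n](subrK k); apply: (map_f (fun f => f + k)).
    by move=> /(_ isT); case: (phi false (f' + k)); case: (phi false (f + k)).
  - by move=> h hF hE; apply: flip_y_inj => //; rewrite yfx.
  - by move=> h hF hE; apply: flip_x_inj.
have flip_const k f : f \in flip_seq d -> phi false (f + k) = phi false k.
  have [a] := ubnP (x f); elim: a f => // a IH f; rewrite ltnS => xfa fF.
  have [x0|x_gt0] := posnP (x f).
    rewrite (_ : f = 0) ?add0r //; apply: flip_x_inj; rewrite ?mem_head //.
    by apply: val_inj; rewrite /= x0 flip_x0.
  have yS := flip_yS fF x_gt0.
  have [f' f'F xf'] := flip_x_surj (y f).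
  by rewrite (step f f') ?IH // xf' -ltnS yS ltnS.
have to0 n : phi false n = phi false 0.
  have eF i : - 'e_i \in flip_seq d by apply/mem_flip_seq; right; exists i.
  elim/lattice_ind: n => [//|v i <-|v i <-]; last by rewrite addrC flip_const.
  by have := flip_const (v + 'e_i) _ (eF i); rewrite addrC addrK.
by move=> n m; rewrite (to0 n) (to0 m).
Qed.
End Rigidity.

(** * Potentials of integer forms on the lattice *)

(** The primitive of [G] that vanishes at zero; the sums for negative arguments
run backwards from zero. *)
Definition int_primitive (G : int -> int) (j : int) : int :=
  match j with
  | Posz k => \sum_(i < k) G i
  | Negz k => - \sum_(i < k.+1) G (Negz i)
  end.

Lemma int_primitiveS G j : int_primitive G (j + 1) = int_primitive G j + G j.
Proof.
case: j => [k|[|k]].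
- by rewrite -PoszD addn1 /= big_ord_recr.
- by rewrite (_ : Negz 0 + 1 = 0) //= big_ord0 big_ord1 addNr.
- rewrite (_ : Negz k.+1 + 1 = Negz k); last by lia.
  by rewrite /= [in RHS]big_ord_recr /= opprD addrNK.
Qed.

(** A closed one-form on the lattice has a potential. The potential is built one
direction at a time: what remains to be integrated along the direction [l] is
invariant under the previous directions, so that a primitive along the lines
parallel to [l] completes the potential without spoiling it. *)
Lemma closed_form_exact d (g : 'I_d -> 'rV[int]_d -> int) :
    (forall i j (n : 'rV[int]_d),
       g i n + g j (n + 'e_i) = g j n + g i (n + 'e_j)) ->
  exists2 f : 'rV[int]_d -> int, f 0 = 0 &
    forall i (n : 'rV[int]_d), f (n + 'e_i) = f n + g i n.
Proof.
move=> gC.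
suff /(_ d (leqnn d))[f fP] : forall k, (k <= d)%N ->
    exists f : 'rV[int]_d -> int,
    forall (i : 'I_d) (n : 'rV[int]_d), (i < k)%N -> f (n + 'e_i) = f n + g i n.
  exists (fun n => f n - f 0); first by rewrite subrr.
  by move=> i n; rewrite fP // addrAC.
elim=> [_|k IH kd]; first by exists (fun=> 0).
have [f fP] := IH (ltnW kd).
pose l := Ordinal kd; pose c n : int := g l n - (f (n + 'e_l) - f n).
have cE (i : 'I_d) (n : 'rV[int]_d) : (i < k)%N -> c (n + 'e_i) = c n.
  move=> ik; have e : n + 'e_i + 'e_l = n + 'e_l + 'e_i by rewrite addrAC.
  rewrite /c e !(fP i) //.
  by have := gC i l n; lia.
pose base (n : 'rV[int]_d) : 'rV[int]_d := n - n 0 l *: 'e_l.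
exists (fun n => f n + int_primitive (fun j => c (base n + j *: 'e_l)) (n 0 l)).
move=> i n; rewrite ltnS leq_eqVlt => /orP[/eqP ik|ik].
  have -> : i = l by exact: val_inj.
  have -> : (n + 'e_l) 0 l = n 0 l + 1 by rewrite !mxE !eqxx.
  have -> : base (n + 'e_l) = base n.
    by rewrite /base !mxE !eqxx scalerDl scale1r opprD addrACA subrr addr0.
  rewrite int_primitiveS /base subrK /c; lia.
have il : (i == l) = false by apply/negbTE; rewrite neq_ltn ik.
have -> : (n + 'e_i) 0 l = n 0 l by rewrite !mxE eqxx eq_sym il addr0.
rewrite fP // addrAC; congr (_ + _ + _); congr int_primitive.
have -> : base (n + 'e_i) = base n + 'e_i.
  by rewrite /base !mxE eqxx eq_sym il addr0 addrAC.
by apply: funext => j; rewrite addrAC cE.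
Qed.

(** A constant circulation around unit squares vanishes when the form is bounded:
by discrete Stokes, the circulation around a box of side 3 is [9 * c], and it is
at most 6 in absolute value since its twelve boundary terms lie between 0 and 1
and half of them are subtracted. *)
Lemma box_defect_eq0 (a b : nat -> nat -> int) (c : int) :
    (forall s t, 0 <= a s t <= 1) -> (forall s t, 0 <= b s t <= 1) ->
    (forall s t, a s t + b s.+1 t - b s t - a s t.+1 = c) -> c = 0.
Proof.
move=> a01 b01 abc.
have sumE : 9 * c = a 0%N 0%N + a 1%N 0%N + a 2%N 0%N - a 0%N 3%N - a 1%N 3%N - a 2%N 3%N +
                    b 3%N 0%N + b 3%N 1%N + b 3%N 2%N - b 0%N 0%N - b 0%N 1%N - b 0%N 2%N.
  move: (abc 0%N 0%N) (abc 0%N 1%N) (abc 0%N 2%N) (abc 1%N 0%N) (abc 1%N 1%N) (abc 1%N 2%N)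
        (abc 2%N 0%N) (abc 2%N 1%N) (abc 2%N 2%N) => /=; clear; lra.
move: (a01 0%N 0%N) (a01 1%N 0%N) (a01 2%N 0%N) (a01 0%N 3%N) (a01 1%N 3%N) (a01 2%N 3%N) => /=.
move: (b01 3%N 0%N) (b01 3%N 1%N) (b01 3%N 2%N) (b01 0%N 0%N) (b01 0%N 1%N) (b01 0%N 2%N) => /=.
move: sumE; clear; lia.
Qed.

(** * The height function of an indistinguishable pair *)

Section Heights.
Variables (d : nat) (x y : configuration d 'I_d.+1).
Implicit Types (n m k v : 'rV[int]_d) (i j : 'I_d).
Hypothesis xy_ind : indistinguishable x y.
Hypothesis xy_flip : flip_condition x y.

(** In a Sturmian configuration the letter at [n] counts the directions in which
the height function goes up by one at [n], and these are the directions with the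
largest slopes. The letter at [- 'e_i] is the rank of the slope of direction [i];
hence the height goes up in direction [i] exactly at the letters that are at
least this rank. *)
Definition rise (b : bool) i n : int :=
  ((x (- 'e_i)%R <= side x y b n)%N : nat).

Definition at0 n : int := ((n == 0) : nat).

Lemma rise_bounds b i n : 0 <= rise b i n <= 1.
Proof. by rewrite /rise; case: (_ <= _)%N. Qed.

Lemma flip_xN_eq i j : (x (- 'e_i) == x (- 'e_j)) = (i == j).
Proof.
apply/eqP/eqP=> [e|-> //]; apply/delta_inj/oppr_inj.
by apply: (flip_x_inj xy_flip); rewrite // mem_flip_seq; right; eexists.
Qed.

(** The flip changes the rises exactly as lowering the height at the origin by
one does. *)
Lemma rise_side i n : rise true i n = rise false i n + at0 n - at0 (n + 'e_i).
Proof.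
rewrite /rise /at0 /= addr_eq0; have xi := flip_xN xy_flip i.
have [/mem_flip_seq[->|[j ->]]|nF] := boolP (n \in flip_seq d).
- rewrite eqxx (flip_x0 xy_flip) (flip_y0 xy_flip) eq_sym oppr_eq0.
  by rewrite (negPf (delta_neq0 i)); have := ltn_ord (x (- 'e_i)); lia.
- rewrite oppr_eq0 (negPf (delta_neq0 j)) (inj_eq oppr_inj) (inj_eq (@delta_inj d)).
  have := flip_yN xy_flip j; have := flip_xN_eq j i.
  rewrite -val_eqE /= => <- yj; lia.
- rewrite (flip_eq xy_flip nF); case: eqP => [n0|_]; first by rewrite n0 mem_head in nF.
  case: eqP => [ni|_]; last by lia.
  by case/negP: nF; apply/mem_flip_seq; right; exists i.
Qed.

Lemma local_rise i : local (side x y) (fun b => rise b i).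
Proof.
exact: (local_map (fun a : 'I_d.+1 => ((x (- 'e_i)%R <= a)%N : nat)%:Z)
  (local_letter (side x y))).
Qed.

(** The circulation of the rises around unit squares is a local function, and it
is the same for [x] and [y] because their rises differ by the gradient of a
function. By rigidity it is constant, and then it vanishes because the rises are
bounded. *)
Lemma rise_cocycle i j n :
  rise false i n + rise false j (n + 'e_i) =
  rise false j n + rise false i (n + 'e_j).
Proof.
pose defect b m := (rise b i m + rise b j (m + 'e_i)) -
                   (rise b j m + rise b i (m + 'e_j)).
have loc_sum i1 i2 :=
  local_map2 (fun s t : int => s + t) (local_rise i1)
    (local_shift 'e_i1 (local_rise i2)).
have loc_defect := local_map2 (fun s t : int => s - t) (loc_sum i j) (loc_sum j i).
have defect_side m : defect true m = defect false m.
  rewrite /defect !rise_side.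
  have e : m + 'e_j + 'e_i = m + 'e_i + 'e_j by rewrite addrAC.
  rewrite e; lia.
have const m : defect false m = defect false 0.
  have e : (defect false m == defect false 0) = (defect false 0 == defect false 0).
    apply: (local_rigid xy_ind xy_flip
      (local_map (fun t : int => t == defect false 0) loc_defect)) => p.
    by congr (_ == _); rewrite -/(defect true p) defect_side.
  by apply/eqP; rewrite e.
suff c0 : defect false 0 = 0.
  by apply/eqP; rewrite -subr_eq0 -/(defect false n) const c0.
pose p (s t : nat) : 'rV[int]_d := 'e_i *+ s + 'e_j *+ t.
apply: (@box_defect_eq0 (fun s t => rise false i (p s t))
                        (fun s t => rise false j (p s t))).
- by move=> s t; apply: rise_bounds.
- by move=> s t; apply: rise_bounds.
- move=> s t; rewrite -(const (p s t)) /defect.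
  have -> : p s.+1 t = p s t + 'e_i by rewrite /p mulrSr addrAC.
  have -> : p s t.+1 = p s t + 'e_j by rewrite /p mulrSr addrA.
  lia.
Qed.

Lemma sum_ltn_ord (a : nat) : (a <= d)%N -> (\sum_(l < d) (l < a)%N)%N = a.
Proof.
move=> ad; rewrite -(big_mkord xpredT (fun l : nat => (l < a)%N : nat)).
rewrite (big_cat_nat (n := a)) //= [X in (X + _)%N]big_nat.
rewrite (eq_bigr (fun=> 1%N)) => [|l /andP[_ ->] //].
rewrite -big_nat sum_nat_const_nat subn0 muln1 big_nat big1 ?addn0 //.
by move=> l /andP[al _]; rewrite ltnNge al.
Qed.

(** The letters at the points [- 'e_i] are all the nonzero letters, each once, and
a letter [a] is at least as large as exactly [a] of them. *)
Lemma sum_rise b n : \sum_i rise b i n = (side x y b n)%:Z.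
Proof.
have rk_lt i : ((x (- 'e_i)%R).-1 < d)%N.
  by have := ltn_ord (x (- 'e_i)); have := flip_xN xy_flip i; lia.
pose rk i := Ordinal (rk_lt i).
have rk_inj : injective rk.
  move=> i j /(congr1 val)/= e; apply/eqP; rewrite -flip_xN_eq; apply/eqP/val_inj => /=.
  by have := flip_xN xy_flip i; have := flip_xN xy_flip j; lia.
have a_le : (side x y b n <= d)%N by have := ltn_ord (side x y b n); lia.
rewrite -(sum_ltn_ord a_le) [in RHS](reindex_inj rk_inj) -natz natr_sum.
by apply: eq_bigr => i _; rewrite natz /rise /= (prednK (flip_xN xy_flip i)).
Qed.

End Heights.

Section Balance.
Variables (d : nat) (x y : configuration d 'I_d.+1).
Implicit Types (n m k v : 'rV[int]_d) (i j : 'I_d).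
Hypothesis xy_flip : flip_condition x y.
Variable f : 'rV[int]_d -> int.
Hypothesis fS : forall i n, f (n + 'e_i) = f n + rise x y false i n.

Definition height b n : int := if b then f n - at0 n else f n.

Lemma heightS b i n : height b (n + 'e_i) = height b n + rise x y b i n.
Proof. by rewrite /height; case: b; rewrite fS // rise_side //; lia. Qed.

Lemma local_increment v : local (side x y) (fun b n => height b (n + v) - height b n).
Proof.
elim/lattice_ind: v => [|v i IH|v i IH].
- by apply: local_ext (local_cst _ 0) => b n; rewrite addr0 subrr.
- apply: local_ext (local_map2 (fun s t : int => s + t) IH
    (local_shift v (local_rise x y i))).
  by move=> b n /=; rewrite addrA heightS addrAC.
- apply: local_ext (local_map2 (fun s t : int => s - t) IH
    (local_shift (v - 'e_i) (local_rise x y i))).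
  move=> b n /=; have e : n + v = n + (v - 'e_i) + 'e_i by rewrite -addrA subrK.
  by rewrite e heightS; lia.
Qed.

Lemma increment_side v n : height true (n + v) - height true n =
  height false (n + v) - height false n - at0 (n + v) + at0 n.
Proof. rewrite /height; lia. Qed.

Hypothesis xy_ind : indistinguishable x y.
Hypothesis f0 : f 0 = 0.

(** The increment of the height over [v] changes under the flip at two places
only: at the origin it goes from [f v] to [f v + 1], and at [- v] it goes from
[c = - f (- v)] to [c - 1]. Equality of the sums of squares of the increments
forces [c = f v + 1]. *)
Lemma height_opp v : v != 0 -> f (- v) = - f v - 1.
Proof.
move=> v0; pose A := [:: 0; - v].
have uA : uniq A by rewrite /= inE eq_sym oppr_eq0 v0.
have := @local_sum d _ (side x y) xy_ind (flip_seq d) (flip_eq xy_flip) _ _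
  (fun t : int => t * t) A (local_increment v) uA.
rewrite /A !big_cons !big_nil !increment_side => /(_ _)/wrap[].
  move=> n; rewrite !inE negb_or => /andP[n0 nv].
  by rewrite increment_side /at0 (negPf n0) addr_eq0 (negPf nv) subr0 addr0.
rewrite /height /at0 add0r addNr eqxx oppr_eq0 (negPf v0) f0 /=; lia.
Qed.

(** By the previous computation the flip exchanges the values [f v] and [f v + 1]
of the increment over [v] at two places and changes nothing elsewhere. So the
predicate that the increment is one of these two values is the same for [x] and
[y], and by rigidity it holds everywhere as it holds at the origin. *)
Lemma height_balanced n v : f v <= f (n + v) - f n <= f v + 1.
Proof.
have [->|v0] := eqVneq v 0; first by rewrite addr0 f0 subrr.
pose good (t : int) := (f v <= t <= f v + 1).
have := @local_rigid d x y xy_ind xy_flip _ (local_map good (local_increment v)).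
rewrite /= -/(good _) => /(_ _ 0 n)/wrap[].
  move=> m; rewrite increment_side /height /at0 addr_eq0.
  have [->|m0] := eqVneq m 0.
    by rewrite eq_sym oppr_eq0 (negPf v0) add0r f0 /good /=; lia.
  have [->|mv] := eqVneq m (- v); last by rewrite subr0 addr0.
  by rewrite addNr f0 height_opp // /good /=; lia.
rewrite /height add0r f0 subr0 => <-; rewrite /good; lia.
Qed.

End Balance.

(** * Slopes of balanced functions and total irrationality *)

Section QuasiMorphism.
Variables (R : realType) (V : zmodType) (f : V -> int).
Implicit Types v w : V.
Hypothesis f_bal : forall w v, f v <= f (w + v) - f w <= f v + 1.

Lemma le0_archi (t : R) (c : R) : (forall k : nat, k%:R * t <= c) -> t <= 0.
Proof.
move=> tc; rewrite leNgt; apply/negP => t_gt0.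
have c_ge0 : 0 <= c by have := tc 0; rewrite mul0r.
have := Num.Theory.archi_boundP (divr_ge0 c_ge0 (ltW t_gt0)).
by rewrite ltr_pdivrMr // ltNge tc.
Qed.

Lemma balanced_mulrn v k :
  k.+1%:Z * f v <= f (v *+ k.+1) <= k.+1%:Z * (f v + 1) - 1.
Proof.
elim: k => [|k IH]; first by rewrite mulr1n; lia.
have e : f (v *+ k.+1 + v) = f (v *+ k.+2) by rewrite -mulrSr.
have := f_bal (v *+ k.+1) v; rewrite e.
have -> : k.+2%:Z = k.+1%:Z + 1 by lia.
lia.
Qed.

Lemma balanced_cross v k l :
  l.+1%:Z * f (v *+ k.+1) <= k.+1%:Z * (f (v *+ l.+1) + 1).
Proof.
have /andP[lo _] := balanced_mulrn (v *+ k.+1) l.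
have /andP[_ up] := balanced_mulrn (v *+ l.+1) k.
rewrite -!mulrnA mulnC in lo up.
by apply: le_trans lo _; apply: le_trans up _; lia.
Qed.

(** The balance condition makes [f] superadditive and [f + 1] subadditive, so
that [f (v *+ k) / k] has a limit, equal to its supremum by Fekete's lemma. *)
Definition slope v : R := sup [set (f (v *+ k.+1))%:~R / k.+1%:R | k in setT].

(** By [balanced_cross] each [(f (v *+ l) + 1) / l] is an upper bound of the set
whose supremum is the slope. *)
Lemma slope_bounds v k :
  (f (v *+ k.+1))%:~R <= k.+1%:R * slope v <= (f (v *+ k.+1))%:~R + 1.
Proof.
have ub l : ubound [set (f (v *+ k.+1))%:~R / k.+1%:R | k in setT]
    (((f (v *+ l.+1))%:~R + 1) / l.+1%:R : R).
  move=> _ [j _ <-]; rewrite ler_pdivrMr ?ltr0n // mulrAC ler_pdivlMr ?ltr0n //.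
  have := balanced_cross v j l; rewrite -(ler_int R) !intrM intrD.
  by rewrite [_ * l.+1%:R]mulrC [_ * j.+1%:R]mulrC.
have sup_v : has_sup [set ((f (v *+ k.+1))%:~R / k.+1%:R : R) | k in setT].
  split; first by exists ((f (v *+ 1))%:~R / 1%:R), 0.
  by exists (((f (v *+ 1))%:~R + 1) / 1%:R); apply: (ub 0).
apply/andP; split.
  rewrite -ler_pdivrMl ?ltr0n // mulrC; by apply: ub_le_sup => //; case: sup_v.
by rewrite -ler_pdivlMl ?ltr0n // mulrC; apply: ge_sup; [case: sup_v|exact: ub].
Qed.

(** The defect of additivity of [f] at [v *+ k] and [w *+ k] is bounded
independently of [k], and [k] times the slope is within 1 of [f]. *)
Lemma slopeD v w : slope (v + w) = slope v + slope w.
Proof.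
have key k : `|k.+1%:R * (slope (v + w) - (slope v + slope w))| <= 2.
  have := slope_bounds (v + w) k; have := slope_bounds v k; have := slope_bounds w k.
  rewrite mulrnDl; have := f_bal (v *+ k.+1) (w *+ k.+1).
  rewrite -(ler_int R) -[in X in _ && X](ler_int R) !rmorphB !rmorphD /=.
  rewrite ler_norml; lra.
apply/eqP; rewrite -subr_eq0 eq_le; apply/andP; split.
  apply: (@le0_archi _ 2) => -[|k]; first by rewrite mul0r.
  by have := key k; rewrite ler_norml => /andP[].
rewrite -oppr_le0; apply: (@le0_archi _ 2) => -[|k]; first by rewrite mul0r.
by have := key k; rewrite ler_norml mulrN => /andP[]; lra.
Qed.

Lemma slope0 : slope 0 = 0.
Proof. by have := slopeD 0 0; rewrite addr0; lra. Qed.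

Lemma slopeN v : slope (- v) = - slope v.
Proof. by have := slopeD (- v) v; rewrite addNr slope0; lra. Qed.

Lemma slope_floor v : (f v)%:~R <= slope v <= (f v)%:~R + 1.
Proof. by have := slope_bounds v 0; rewrite mulr1n mul1r. Qed.

End QuasiMorphism.

Section Irrational.
Variables (R : realType) (d : nat).
Implicit Types (alpha : 'rV[R]_d) (n m v : 'rV[int]_d).

Lemma dotD v n alpha : dot (v + n) alpha = dot v alpha + dot n alpha.
Proof.
by rewrite /dot -big_split; apply: eq_bigr => i _; rewrite mxE intrD mulrDl.
Qed.

Lemma dot0 alpha : dot 0 alpha = 0.
Proof. by rewrite /dot big1 // => i _; rewrite mxE mul0r. Qed.

Lemma dotN v alpha : dot (- v) alpha = - dot v alpha.
Proof.
by rewrite /dot -sumrN; apply: eq_bigr => i _; rewrite mxE intrN mulNr.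
Qed.

Lemma dot_delta i alpha : dot 'e_i alpha = alpha 0 i.
Proof.
rewrite /dot (bigD1 i) //= big1 ?addr0 => [|j ji]; rewrite mxE ?eqxx ?mul1r //.
by rewrite (negPf ji) mul0r.
Qed.

Lemma dot_additive (a : 'rV[int]_d -> R) : (forall v w, a (v + w) = a v + a w) ->
  forall v, a v = dot v (\row_i a 'e_i).
Proof.
move=> aD; elim/lattice_ind => [|v i IH|v i IH].
- by rewrite dot0; have := aD 0 0; rewrite addr0; lra.
- by rewrite aD dotD IH dot_delta mxE.
- have := aD (v - 'e_i) 'e_i; rewrite subrK dotD dotN dot_delta mxE IH; lra.
Qed.

Lemma common_denominator (I : finType) (q : I -> rat) :
  exists2 N : int, N != 0 & exists w : I -> int, forall i, N%:~R * q i = (w i)%:~R.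
Proof.
exists (\prod_i denq (q i)); first by apply/prodf_neq0 => i _; rewrite denq_neq0.
exists (fun i => numq (q i) * \prod_(j | j != i) denq (q j)) => i.
rewrite (bigD1 i) //= !intrM mulrAC [_%:~R * q i]mulrC.
by rewrite -{1}[q i]divq_num_den divfK ?intr_eq0 ?denq_neq0.
Qed.

(** Clearing denominators turns a rational relation between 1 and the entries of
[alpha] into a lattice vector whose product with [alpha] is an integer. *)
Lemma totally_irrationalP alpha :
  totally_irrational alpha <->
  forall v (m : int), dot v alpha = m%:~R -> v = 0.
Proof.
split=> [irr v m e|irr q0 q e].
  have [|_ v0] := irr (- m)%:~R (fun i => (v 0 i)%:~R).
    rewrite ratr_int intrN -e addrC; apply/eqP; rewrite subr_eq0; apply/eqP.
    by apply: eq_bigr => i _; rewrite ratr_int.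
  by apply/rowP => i; rewrite mxE; apply/eqP; rewrite -(intr_eq0 rat) v0.
have [N N0 [w wE]] := common_denominator (fun o => if o is Some i then q i else q0).
have wR (r : rat) (k : int) : N%:~R * r = k%:~R -> N%:~R * ratr r = k%:~R :> R.
  by move=> Nr; rewrite -[RHS](ratr_int R) -Nr rmorphM /= ratr_int.
have q_0 i : q i = 0.
  have v0 : \row_i w (Some i) = 0.
    apply: (irr _ (- w None)).
    have -> : dot (\row_i w (Some i)) alpha =
        N%:~R * \sum_(i < d) ratr (q i) * alpha 0 i.
      rewrite big_distrr; apply: eq_bigr => j _ /=.
      by rewrite mxE mulrA (wR _ _ (wE (Some j))).
    apply/eqP; rewrite intrN -addr_eq0 -(wR _ _ (wE None)) -mulrDr addrC.
    by rewrite e mulr0.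
  have /eqP := wE (Some i); have /rowP/(_ i) := v0; rewrite !mxE => ->.
  by rewrite mulf_eq0 intr_eq0 (negPf N0) => /eqP.
split=> //; move: e; rewrite big1 ?addr0 => [/eqP|i _].
  by rewrite fmorph_eq0 => /eqP.
by rewrite q_0 rmorph0 mul0r.
Qed.

End Irrational.

(** * Indistinguishable pairs are Sturmian *)

Section Forward.
Variables (R : realType) (d : nat) (x y : configuration d 'I_d.+1).
Implicit Types (n m v : 'rV[int]_d) (i j : 'I_d).
Hypothesis x_ur : uniformly_recurrent x.
Hypothesis xy_ind : indistinguishable x y.
Hypothesis xy_flip : flip_condition x y.
Variable f : 'rV[int]_d -> int.
Hypothesis f0 : f 0 = 0.
Hypothesis fS : forall i n, f (n + 'e_i) = f n + rise x y false i n.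

Let f_bal := height_balanced xy_flip fS xy_ind f0.

(** The larger increment [f v + 1] over [v] occurs at [- v], and by uniform
recurrence it occurs within a bounded distance from each multiple of [v]. By the
pigeonhole principle two of these occurrences lie on one line directed by [v]. *)
Lemma increment_recurs v : v != 0 -> exists p r,
  f (p + v) - f p = f v + 1 /\
  f (p + v *+ r.+1 + v) - f (p + v *+ r.+1) = f v + 1.
Proof.
move=> v0; have [S loc] := local_increment xy_flip fS v.
have incN : f (- v + v) - f (- v) = f v + 1.
  by rewrite addNr f0 (height_opp xy_flip fS xy_ind f0 v0); lia.
have [K KP] := x_ur (ex_intro
  (fun n => occ (@restriction _ _ S (shift (- v) x)) x n) (- v) erefl).
have hit t : exists k : K, f (v *+ t + val k + v) - f (v *+ t + val k) = f v + 1.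
  have [k kK kocc] := KP (v *+ t); exists [` kK]%fset; rewrite -incN.
  apply: (loc false false) => s sS.
  by have := congr1 (fun q => q [` sS]%fset) kocc.
pose kappa (t : 'I_#|{: K}|.+1) : K := projT1 (cid (hit t)).
have kappaP (t : 'I_#|{: K}|.+1) :
    f (v *+ t + val (kappa t) + v) - f (v *+ t + val (kappa t)) = f v + 1.
  exact: projT2 (cid (hit t)).
have : ~~ injectiveb kappa.
  apply/injectiveP => /leq_card; by rewrite card_ord ltnn.
move=> /injectivePn[s [t st est]].
wlog lt_st : s t st est / (s < t)%N.
  move=> W; have [st'|st'|st'] := ltngtP s t; first exact: (W s t).
    by apply: (W t s) => //; rewrite eq_sym.
  by move/eqP: st; case; apply: val_inj.
exists (v *+ s + val (kappa s)), (t - s.+1)%N; split; first exact: kappaP.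
have <- : v *+ t + val (kappa t) = v *+ s + val (kappa s) + v *+ (t - s.+1).+1.
  by rewrite addrAC -mulrnDr est; congr (_ *+ _ + _); lia.
exact: kappaP.
Qed.

(** If the slope of [v] were the integer [f v], then along a line directed by [v]
all increments over [v] would be at least [f v], and two of them would be larger
by the previous lemma; but over a long segment the total increment exceeds the
slope by at most 1. *)
Lemma slope_height_eq0 v : slope R f v = (f v)%:~R -> v = 0.
Proof.
move=> av; apply/eqP; apply: contraT => v0.
have [p [r [inc1 inc2]]] := increment_recurs v0.
have up : f (v *+ r.+2) <= r.+2%:Z * f v.
  have /andP[+ _] := slope_bounds R f_bal v r.+1.
  by rewrite av -[r.+2%:R]/(r.+2%:Z%:~R) -intrM ler_int.
have lo : r%:Z * f v <= f (v *+ r).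
  case: r {inc2 up} => [|r]; first by rewrite mulr0n f0 mul0r.
  by have /andP[] := balanced_mulrn f_bal v r.
have e1 : f (p + v + v *+ r) = f (p + v *+ r.+1) by rewrite -addrA -mulrS.
have e2 : f (p + v *+ r.+2) = f (p + v *+ r.+1 + v) by rewrite -addrA -mulrSr.
have := f_bal (p + v) (v *+ r); have := f_bal p (v *+ r.+2).
rewrite e1 e2.
have r2 : r.+2%:Z * f v = r%:Z * f v + f v + f v by lia.
move: up inc1 inc2 lo; rewrite r2; move: (r%:Z * f v); lia.
Qed.

(** The integral slope of [v] is [f v] or [f v + 1]; in the second case the slope
of [- v] is [f (- v)]. *)
Lemma slope_irrational v (m : int) : slope R f v = m%:~R -> v = 0.
Proof.
move=> av; have := slope_floor R f_bal v; rewrite av -intrD1 !ler_int => /andP[lo up].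
have [fm|fm] := eqVneq (f v) m; first by apply: slope_height_eq0; rewrite fm.
have [->//|v0] := eqVneq v 0; apply: oppr_inj; rewrite oppr0; apply: slope_height_eq0.
by rewrite slopeN // av (height_opp xy_flip fS xy_ind f0 v0) -intrN; congr (_%:~R); lia.
Qed.

Lemma height_floor v : f v = Num.floor (slope R f v).
Proof.
have [->|v0] := eqVneq v 0; first by rewrite f0 slope0 // floor0.
apply/esym/floor_def; have /andP[lo up] := slope_floor R f_bal v.
rewrite lo intrD lt_neqAle up andbT; apply/eqP => e; move/eqP: v0; apply.
by apply: (@slope_irrational v (f v + 1)); rewrite intrD.
Qed.

Lemma height_ceil v : height f true v = Num.ceil (slope R f v) - 1.
Proof.
rewrite /height /at0; have [->|v0] := eqVneq v 0; first by rewrite f0 slope0 // ceil0.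
rewrite subr0 height_floor ceil_floor.
suff -> : (slope R f v \is a Num.int) = false by rewrite addrK.
apply/negP => /intrP[m av]; move/eqP: v0; apply; exact: slope_irrational av.
Qed.

Lemma sturmian_of_height : exists alpha : 'rV[R]_d,
     [/\ totally_irrational alpha,
         forall i : 'I_d, 0 <= alpha 0 i < 1,
         forall n : 'rV[int]_d, (x n)%:Z = lower_sturmian alpha n &
         forall n : 'rV[int]_d, (y n)%:Z = upper_sturmian alpha n].
Proof.
pose alpha : 'rV[R]_d := \row_i slope R f 'e_i; exists alpha.
have aE v : slope R f v = dot v alpha by apply: dot_additive; exact: slopeD.
have irr : totally_irrational alpha.
  by apply/totally_irrationalP => v m; rewrite -aE; apply: slope_irrational.
have dotS i n : alpha 0 i + dot n alpha = dot (n + 'e_i) alpha.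
  by rewrite dotD dot_delta addrC.
split=> // [i|n|n].
- rewrite -dot_delta -aE; have := slope_floor R f_bal 'e_i.
  have := fS i 0; rewrite add0r f0 /rise /= (flip_x0 xy_flip) leqNgt.
  rewrite (flip_xN xy_flip) /= => fe.
  rewrite fe mulr0z !add0r => /andP[-> /= a1]; rewrite lt_neqAle a1 andbT.
  apply/eqP => e; have := delta_neq0 i; rewrite (@slope_irrational 'e_i 1) ?eqxx //.
- rewrite /lower_sturmian -[x n]/(side x y false n) -(sum_rise xy_flip).
  apply: eq_bigr => i _; rewrite dotS -!aE -!height_floor fS; lia.
- rewrite /upper_sturmian -[y n]/(side x y true n) -(sum_rise xy_flip).
  apply: eq_bigr => i _; rewrite dotS -!aE.
  have := height_ceil (n + 'e_i); rewrite (heightS xy_flip fS) height_ceil; lia.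
Qed.

End Forward.

(** * Sturmian pairs are indistinguishable *)

Section UpperFractionalPart.
Variable R : realType.
Implicit Types t z r : R.

(** The representative in the interval ]0, 1] of [t] modulo the integers. *)
Definition upfrac t : R := t - (Num.ceil t)%:~R + 1.

Lemma upfrac_itv t : 0 < upfrac t <= 1.
Proof.
rewrite /upfrac; have := ceil_itv t; rewrite intrD intrN; lra.
Qed.

Lemma upfrac_eq t r (k : int) : 0 < r <= 1 -> t = r + k%:~R -> upfrac t = r.
Proof.
move=> r01 ->; rewrite /upfrac (@ceil_def _ _ (k + 1)) ?intrD; lra.
Qed.

(** The smallest positive shift that takes [z] to an integer is [upfrac (- z)].
A shift that is no larger does not jump over any integer, so that after it the
right-continuous reading of [z] becomes the left-continuous reading. *)
Lemma ceilD_floor z t : upfrac t <= upfrac (- z) ->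
  Num.ceil (z + t) = Num.floor z + Num.ceil t.
Proof.
move=> le_zt; apply: ceil_def; have := upfrac_itv t; have := floor_itv z.
move: le_zt; rewrite /upfrac (ceilNfloor (- z)) opprK !(intrD, intrN); lra.
Qed.

End UpperFractionalPart.

Lemma seq_argmin (R : realType) (T : eqType) (F : T -> R) (s : seq T) a : a \in s ->
  exists2 m, m \in s & forall k, k \in s -> F m <= F k.
Proof.
elim: s a => // b [|c s] IH a _.
  by exists b; rewrite ?mem_head // => k; rewrite inE => /eqP->.
have [m ms mP] := IH c (mem_head _ _).
have [Fb|Fb] := lerP (F b) (F m).
  exists b; rewrite ?mem_head // => k; rewrite inE => /orP[/eqP->//|/mP].
  exact: le_trans.
exists m; first by rewrite inE ms orbT.
by move=> k; rewrite inE => /orP[/eqP->|/mP//]; exact: ltW.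
Qed.

Section Converse.
Variables (R : realType) (d : nat) (d_ge1 : (1 <= d)%N).
Variables (x y : configuration d 'I_d.+1) (alpha : 'rV[R]_d).
Implicit Types (n m v : 'rV[int]_d) (i j : 'I_d).
Hypothesis alpha_irr : totally_irrational alpha.
Hypothesis alpha01 : forall i, 0 <= alpha 0 i < 1.
Hypothesis xE : forall n, (x n)%:Z = lower_sturmian alpha n.
Hypothesis yE : forall n, (y n)%:Z = upper_sturmian alpha n.

Let dotZ v (k : int) : dot v alpha = k%:~R -> v = 0.
Proof. exact: (totally_irrationalP alpha).1. Qed.

Lemma lower_dot n :
  (x n)%:Z = \sum_i (Num.floor (dot (n + 'e_i) alpha) - Num.floor (dot n alpha)).
Proof.
by rewrite xE; apply: eq_bigr => i _; rewrite dotD dot_delta [dot n alpha + _]addrC.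
Qed.

Lemma upper_dot n :
  (y n)%:Z = \sum_i (Num.ceil (dot (n + 'e_i) alpha) - Num.ceil (dot n alpha)).
Proof.
by rewrite yE; apply: eq_bigr => i _; rewrite dotD dot_delta [dot n alpha + _]addrC.
Qed.

(** By total irrationality the origin is the only lattice point where the floor
and the ceiling of [dot n alpha] agree. *)
Lemma ceil_dot n : Num.ceil (dot n alpha) = Num.floor (dot n alpha) + (n != 0).
Proof.
rewrite ceil_floor; suff -> : (dot n alpha \is a Num.int) = (n == 0) by [].
by apply/intrP/eqP => [[k /dotZ//]|->]; exists 0; rewrite dot0.
Qed.

Lemma upper_lower n : (y n)%:Z = (x n)%:Z +
  \sum_i (((n == 0) : nat)%:Z - ((n + 'e_i == 0) : nat)%:Z).
Proof.
rewrite lower_dot upper_dot -big_split; apply: eq_bigr => i _ /=.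
by rewrite !ceil_dot; case: (n == 0); case: (n + 'e_i == 0) => /=; lia.
Qed.

Lemma sturmian_x0 : x 0 = 0 :> nat.
Proof.
apply/eqP; rewrite -eqz_nat lower_dot big1 // => i _.
by rewrite add0r dot0 floor0 dot_delta subr0; apply: floor_def.
Qed.

Lemma sturmian_y0 : y 0 = d :> nat.
Proof.
apply/eqP; rewrite -eqz_nat upper_lower sturmian_x0 add0r.
rewrite (eq_bigr (fun=> 1%Z)) => [|i _]; last by rewrite add0r eqxx (negPf (delta_neq0 i)).
by rewrite sumr_const card_ord natz.
Qed.

Lemma sturmian_yN j : (y (- 'e_j)).+1 = x (- 'e_j) :> nat.
Proof.
have := upper_lower (- 'e_j); rewrite (bigD1 j) //= addNr eqxx oppr_eq0.
rewrite (negPf (delta_neq0 j)) big1 => [|i ij]; first by lia.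
by rewrite addr_eq0 (inj_eq oppr_inj) (inj_eq (@delta_inj d)) eq_sym (negPf ij).
Qed.

Lemma sturmian_eq n : n \notin flip_seq d -> x n = y n.
Proof.
move=> nF; apply: val_inj; apply/eqP; rewrite -eqz_nat upper_lower.
rewrite big1 ?addr0 // => i _; rewrite addr_eq0.
case: eqP => [n0|_]; first by rewrite n0 mem_head in nF.
case: eqP => [ni|//]; case/negP: nF; apply/mem_flip_seq; right.
by exists i.
Qed.

(** The height is [-1] at [- 'e_j], and the step from there in direction [i] goes
up exactly when [alpha 0 i] is at least [alpha 0 j]. Hence distinct slopes give
distinct letters. *)
Lemma sturmian_xN j : (x (- 'e_j))%:Z = \sum_i ((alpha 0 j <= alpha 0 i)%R : nat)%:Z.
Proof.
rewrite lower_dot; apply: eq_bigr => i _; rewrite dotD !dotN !dot_delta.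
have /andP[i0 i1] := alpha01 i; have /andP[j0 j1] := alpha01 j.
have j_gt0 : 0 < alpha 0 j.
  rewrite lt_neqAle j0 andbT eq_sym; apply/eqP => aj0.
  have /eqP := delta_neq0 j; apply; apply: (@dotZ _ 0).
  by rewrite dot_delta.
rewrite (@floor_def _ (- alpha 0 j) (-1)); last by rewrite intrN; lra.
have [le_ji|lt_ij] := lerP (alpha 0 j) (alpha 0 i) => /=.
  by rewrite (@floor_def _ _ 0) //; lra.
by rewrite (@floor_def _ _ (-1)) // intrN; lra.
Qed.

Lemma sturmian_inj : {in flip_seq d &, injective x}.
Proof.
have lt_x j l : alpha 0 j < alpha 0 l -> (x (- 'e_l) < x (- 'e_j))%N.
  move=> jl; rewrite -ltz_nat !sturmian_xN (bigD1 j) //= [X in _ < X](bigD1 j) //=.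
  rewrite lexx leNgt jl /= add0r [ltRHS]addrC.
  rewrite ltzD1; apply: ler_sum => i _.
  by have [li|//] := lerP (alpha 0 l) (alpha 0 i); rewrite (le_trans (ltW jl) li).
have xN_inj j l : x (- 'e_j) = x (- 'e_l) -> j = l.
  move=> e; have [/lt_x|/lt_x|ejl] := ltgtP (alpha 0 j) (alpha 0 l); rewrite ?e ?ltnn //.
  apply/delta_inj/eqP; rewrite -subr_eq0; apply/eqP; apply: (@dotZ _ 0).
  by rewrite dotD dotN !dot_delta ejl subrr.
have xN_neq j : x (- 'e_j) != x 0.
  by rewrite -val_eqE /= -sturmian_yN sturmian_x0.
move=> n m /mem_flip_seq[->|[j ->]] /mem_flip_seq[->|[l ->]] e //.
- by move: (xN_neq l); rewrite e eqxx.
- by move: (xN_neq j); rewrite e eqxx.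
- by rewrite (xN_inj _ _ e).
Qed.

(** Place the points [dot k alpha] for [k] in [A] on the circle of reals modulo
the integers. The letters of [x] in the window at [n] are coded by floors and
those of [y] in the window at [m] by ceilings of the same linear forms. The
values of these forms can pass an integer only at points of [A], and when [m] is
the first point of [A] strictly after [n] none is passed on the way. *)
Lemma successor_agree (S : {fset 'rV[int]_d}) (A : seq 'rV[int]_d) n m :
    (forall f s, f \in flip_seq d -> s \in S -> f - s \in A) ->
    (forall k, k \in A ->
       upfrac (dot m alpha - dot n alpha) <= upfrac (dot k alpha - dot n alpha)) ->
  agree S x n y m.
Proof.
move=> SA mP s sS; apply: val_inj; apply/eqP; rewrite -eqz_nat lower_dot upper_dot.
have key f : f \in flip_seq d -> Num.ceil (dot (m + (s - f)) alpha) =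
    Num.floor (dot (n + (s - f)) alpha) + Num.ceil (dot m alpha - dot n alpha).
  move=> fF; rewrite -ceilD_floor; last first.
    have -> : - dot (n + (s - f)) alpha = dot (f - s) alpha - dot n alpha.
      by rewrite !(dotD, dotN); ring.
    exact/mP/SA.
  by congr Num.ceil; rewrite !dotD; ring.
apply/eqP/eq_bigr => i _; have := key 0 (mem_head _ _); rewrite subr0 => ->.
have := key (- 'e_i); rewrite opprK !addrA => ->.
  by rewrite opprD addrACA subrr addr0.
by apply/mem_flip_seq; right; exists i.
Qed.

(** The cyclic successor on the circle permutes the finite set [A] of all places
whose window meets the flip set, and it sends each place to one where [y] shows
the pattern that [x] shows at the former. *)
Lemma sturmian_indistinguishable : indistinguishable x y.
Proof.
move=> S; pose A := undup [seq f - s | f <- flip_seq d, s <- enum_fset S].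
have SA f s : f \in flip_seq d -> s \in S -> f - s \in A.
  by move=> fF sS; rewrite mem_undup; exact: (allpairs_f (fun f s => f - s)).
have uA : uniq A by exact: undup_uniq.
pose theta n m := upfrac (dot m alpha - dot n alpha).
have minA n : exists m, n \in A ->
    m \in A /\ forall k, k \in A -> theta n m <= theta n k.
  have [nA|nA] := boolP (n \in A); last by exists n.
  by have [m mA mP] := seq_argmin (theta n) nA; exists m.
have [succ succP] := choice minA.
have succ_inj : {in A &, injective succ}.
  (* Were [n'] strictly between [n] and its successor, [n'] would be a closer
     successor of [n]. *)
  have theta_lt n n' : n \in A -> n' \in A ->
      theta n' (succ n) < theta n (succ n) -> False.
    move=> nA n'A lt_theta.
    have := (succP n nA).2 n' n'A.
    have -> : theta n n' = theta n (succ n) - theta n' (succ n).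
      apply: (@upfrac_eq _ _ _ (Num.ceil (dot (succ n) alpha - dot n alpha) -
        Num.ceil (dot (succ n) alpha - dot n' alpha))).
        have := upfrac_itv (dot (succ n) alpha - dot n alpha).
        have := upfrac_itv (dot (succ n) alpha - dot n' alpha).
        by move: lt_theta; rewrite /theta; lra.
      by rewrite /theta /upfrac intrD intrN; ring.
    have := upfrac_itv (dot (succ n) alpha - dot n' alpha).
    by rewrite -/(theta n' (succ n)); lra.
  move=> n n' nA n'A e.
  have [lt|lt|e'] := ltgtP (theta n (succ n)) (theta n' (succ n)).
  - by case: (theta_lt n' n) => //; rewrite -e.
  - by case: (theta_lt n n').
  - apply/eqP; rewrite -subr_eq0; apply/eqP.
    apply: (@dotZ _ (Num.ceil (dot (succ n) alpha - dot n' alpha) -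
        Num.ceil (dot (succ n) alpha - dot n alpha))).
    by move: e'; rewrite /theta /upfrac intrD intrN dotD dotN; lra.
have perm_succ : perm_eq [seq succ n | n <- A] A.
  have us : uniq [seq succ n | n <- A] by rewrite map_inj_in_uniq.
  have sA : {subset [seq succ n | n <- A] <= A}.
    by move=> _ /mapP[n nA ->]; exact: (succP n nA).1.
  apply: uniq_perm => //; apply: (uniq_min_size us sA _).2.
  by rewrite size_map.
have diffA n : n \notin A -> agree S x n y n.
  move=> nA s sS; apply: sturmian_eq; apply: contra nA => nsF.
  by rewrite -[n](addrK s); exact: SA.
apply/(indistinguishable_permP uA diffA).
apply: perm_trans (perm_map _ perm_succ); rewrite -map_comp.
suff -> : [seq pattern_at S x n | n <- A] = [seq (pattern_at S y \o succ) n | n <- A] by [].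
apply/eq_in_map => n nA; apply/pattern_atP.
exact: successor_agree SA (succP n nA).2.
Qed.

Lemma sturmian_flip : flip_condition x y.
Proof.
have y_pred n : n \in flip_seq d -> y n = ord_pred (x n).
  case/mem_flip_seq => [->|[j ->]]; apply: val_inj; rewrite /=.
    by rewrite sturmian_x0 sturmian_y0 add0n modn_small.
  by rewrite -sturmian_yN addSn /= modnDr modn_small.
split.
- apply/seteqP; split=> n /=.
    by move=> xy; apply/mem_flip_seq; apply: contrapT => /negP/sturmian_eq.
  case=> [->|[j ->]] e.
    by move: d_ge1; rewrite -sturmian_y0 -e sturmian_x0.
  by have := sturmian_yN j; rewrite e; lia.
- split=> [n _ //|n m /set_mem/mem_flip_seq nF /set_mem/mem_flip_seq mF|a _].
    exact: sturmian_inj.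
  have us : uniq [seq x n | n <- flip_seq d].
    by rewrite map_inj_in_uniq ?uniq_flip_seq //; exact: sturmian_inj.
  have us_sub : {subset [seq x n | n <- flip_seq d] <= enum 'I_d.+1}.
    by move=> b _; rewrite mem_enum.
  have size_le : (size (enum 'I_d.+1) <= size [seq x n | n <- flip_seq d])%N.
    by rewrite size_map /= size_map -!cardE !card_ord.
  have := (uniq_min_size us us_sub size_le).2 a.
  by rewrite mem_enum => /mapP[n /mem_flip_seq nF ->]; exists n.
- pose s := perm (can_inj (@ord_predK d.+1)); exists s; split.
    by move=> n /mem_flip_seq nF; rewrite permE y_pred.
  suff -> : porbit s ord0 = [set: 'I_d.+1]%SET by rewrite cardsT card_ord.
  apply/setP => a; rewrite inE; case: a; elim=> [a_lt|a IH a_lt].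
    by rewrite (_ : Ordinal _ = ord0) ?porbit_id //; exact: val_inj.
  have sa : (s ^+ 1)%g (Ordinal a_lt) = Ordinal (ltnW a_lt).
    by rewrite expg1 permE; apply: val_inj; rewrite /= modnDr modn_small // ltnW.
  by rewrite -eq_porbit_mem -(porbit_perm s 1) sa eq_porbit_mem IH.
- by apply: val_inj; rewrite /= sturmian_x0.
- move=> n [->|[j ->]].
    by rewrite sturmian_x0 sturmian_y0 (_ : 0%:Z - 1 = Negz 0) // modNz_nat // mod0n; lia.
  rewrite -sturmian_yN modz_small; have := ltn_ord (y (- 'e_j)); lia.
Qed.

End Converse.

(** * The characterization *)

Theorem theorem2 (R : realType) (d : nat) (d_ge1 : (1 <= d)%N)
    (x y : configuration d 'I_d.+1) (x_ur : uniformly_recurrent x) :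
  (indistinguishable_asymptotic_pair x y /\ flip_condition x y) <->
  (exists alpha : 'rV[R]_d,
     [/\ totally_irrational alpha,
         forall i : 'I_d, 0 <= alpha 0 i < 1,
         forall n : 'rV[int]_d, (x n)%:Z = lower_sturmian alpha n &
         forall n : 'rV[int]_d, (y n)%:Z = upper_sturmian alpha n]).
Proof.
split=> [[[_ xy_ind] xy_flip]|[alpha [alpha_irr alpha01 xE yE]]].
  have [f f0 fS] := closed_form_exact (rise_cocycle xy_ind xy_flip).
  exact: sturmian_of_height f0 fS.
have xy_flip := sturmian_flip d_ge1 alpha_irr alpha01 xE yE.
split=> //; split; last exact: sturmian_indistinguishable xE yE.
rewrite /asymptotic (flip_diff xy_flip).
rewrite (_ : flip_set d = [set` flip_seq d]); first exact: finite_seq.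
by apply/seteqP; split=> n /mem_flip_seq.
Qed.
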